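(* Let $(M,J)$ be a compact complex manifold of complex dimension at least $3$, let $t\in\mathbb{R}$, and let $\omega$ be an lcK metric on $(M,J)$ such that $\mathrm{Ric}^{t,1}=f\omega$ for some smooth function $f$ on $M$. Then either $f\equiv 0$, or $\omega$ is globally conformally K\''ahler and $f$ has a sign (i.e. $f$ is everywhere positive or everywhere negative).
   Context: Let $(M,J,g)$ be a connected Hermitian manifold of complex dimension $n$, with fundamental form $\omega=g(J\cdot,\cdot)$. It is locally conformally K\''ahler (lcK) if $d\omega=\theta\wedge\omega$ for a closed real 1-form $\theta$, the Lee form (K\''ahler metrics, $\theta=0$, are allowed); it is globally conformally K\''ahler if $\theta$ is exact. $\theta^\sharp$ is the $g$-dual vector field of $\theta$ and $\nabla^g$ the Levi-Civita connection. For $t\in\mathbb{R}$, the Gauduchon connection $\nabla^t$ is Gauduchon's canonical Hermitian connection of parameter $t$ ($t=1$: Chern; $t=-1$: Bismut); for an lcK metric it is $$\nabla^t_XY=\nabla^g_XY-\tfrac{t}{2}\theta(JX)JY+\tfrac{t-1}{4}\theta(JY)JX+\tfrac{t-1}{4}\omega(X,Y)J\theta^\sharp-\tfrac{t+1}{4}\theta(Y)X+\tfrac{t+1}{4}g(X,Y)\theta^\sharp .$$ With curvature $R^{\nabla}_{X,Y}=[\nabla_X,\nabla_Y]-\nabla_{[X,Y]}$ and a $g$-orthonormal basis $e_1,\dots,e_{2n}$, the first Gauduchon--Ricci form is $$\mathrm{Ric}^{t,1}(X,Y)=-\tfrac12\sum_{i=1}^{2n}g(R^{\nabla^t}_{X,Y}e_i,Je_i).$$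 *)

(* Defs.v *)
(* MathComp-Analysis *)
From HB Require Import structures.
From mathcomp Require Import all_boot all_order all_algebra.
From mathcomp Require Import all_classical all_reals all_analysis.

Set Implicit Arguments.
Unset Strict Implicit.
Unset Printing Implicit Defensive.

Import Order.TTheory GRing.Theory Num.Theory.
Import numFieldNormedType.Exports.

Local Open Scope classical_set_scope.
Local Open Scope ring_scope.

(* C^k on an open set U of a finite-dimensional space *)
Fixpoint Ck (R : realType) (V W : normedModType R) (k : nat) (U : set V)
    (f : V -> W) : Prop :=
  if k is k'.+1 then
    (forall x, U x -> differentiable f x) /\
    (forall v, Ck k' U (fun x => 'D_v f x))
  else forall x, U x -> {for x, continuous f}.

Definition smooth (R : realType) (V W : normedModType R) (U : set V)
    (f : V -> W) : Prop := forall k, Ck k U f.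

(* C^n is 'rV[R]_(n + n) with coordinates (x_1..x_n, y_1..y_n), z_k = x_k + i y_k;
   stdJ is multiplication by i. *)
Definition stdJ (R : realType) (n : nat) (v : 'rV[R]_(n + n)) : 'rV[R]_(n + n) :=
  row_mx (- rsubmx v) (lsubmx v).

(* smooth with complex-linear differential (Cauchy-Riemann equations) *)
Definition holomorphic (R : realType) (n : nat) (U : set 'rV[R]_(n + n))
    (f : 'rV[R]_(n + n) -> 'rV[R]_(n + n)) : Prop :=
  smooth U f /\ forall x v, U x -> 'D_(stdJ v) f x = stdJ ('D_v f x).

(* chart_inv c is only meaningful on the image of chart c, and chart c on its
   domain. The atlas need not be maximal. *)
Record complexManifold (R : realType) (n : nat) := ComplexManifold {
  carrier :> topologicalType;
  carrier_hausdorff : hausdorff_space carrier;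
  carrier_second_countable : @second_countable carrier;
  chart_index : Type;
  chart_dom : chart_index -> set carrier;
  chart : chart_index -> carrier -> 'rV[R]_(n + n);
  chart_inv : chart_index -> 'rV[R]_(n + n) -> carrier;
  chart_dom_open : forall c, open (chart_dom c);
  chart_dom_cover : forall p, exists c, chart_dom c p;
  chart_image_open : forall c, open (chart c @` chart_dom c);
  chartK : forall c p, chart_dom c p -> chart_inv c (chart c p) = p;
  chart_continuous : forall c, {within chart_dom c, continuous (chart c)};
  chart_inv_continuous :
    forall c, {within chart c @` chart_dom c, continuous (chart_inv c)};
  transition_holomorphic : forall c d,
    holomorphic (chart c @` (chart_dom c `&` chart_dom d))
                (chart d \o chart_inv c) }.

Arguments chart_index {R n} _.
Arguments chart_dom {R n} _ _ _.
Arguments chart {R n} _ _ _.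
Arguments chart_inv {R n} _ _ _.

Definition chart_image (R : realType) (n : nat) (M : complexManifold R n)
    (c : chart_index M) : set 'rV[R]_(n + n) := chart M c @` chart_dom M c.

Definition overlap (R : realType) (n : nat) (M : complexManifold R n)
    (c d : chart_index M) : set 'rV[R]_(n + n) :=
  chart M c @` (chart_dom M c `&` chart_dom M d).

Definition transition (R : realType) (n : nat) (M : complexManifold R n)
    (c d : chart_index M) : 'rV[R]_(n + n) -> 'rV[R]_(n + n) :=
  chart M d \o chart_inv M c.

Definition smooth_fun (R : realType) (n : nat) (M : complexManifold R n)
    (f : M -> R) : Prop :=
  forall c, smooth (chart_image c) (f \o chart_inv M c).

Definition pairing (R : realType) (m : nat) (a v : 'rV[R]_m) : R :=
  (a *m v^T) 0 0.

Definition bilin (R : realType) (m : nat) (G : 'M[R]_m) (u v : 'rV[R]_m) : R :=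
  (u *m G *m v^T) 0 0.

(* Tensor fields are given by their components in each chart, subject to the
   transformation law (pullback under the transition maps). *)
Record oneForm (R : realType) (n : nat) (M : complexManifold R n) := OneForm {
  form_coef :> chart_index M -> 'rV[R]_(n + n) -> 'rV[R]_(n + n);
  form_smooth : forall c, smooth (chart_image c) (form_coef c);
  form_compat : forall c d x v, overlap c d x ->
    pairing (form_coef c x) v =
    pairing (form_coef d (transition c d x)) ('D_v (transition c d) x) }.

Record hermitianMetric (R : realType) (n : nat) (M : complexManifold R n) :=
  HermitianMetric {
  metric_coef :> chart_index M -> 'rV[R]_(n + n) -> 'M[R]_(n + n);
  metric_smooth : forall c, smooth (chart_image c) (metric_coef c);
  metric_compat : forall c d x u v, overlap c d x ->
    bilin (metric_coef c x) u v =
    bilin (metric_coef d (transition c d x))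
          ('D_u (transition c d) x) ('D_v (transition c d) x);
  metric_sym : forall c x u v, chart_image c x ->
    bilin (metric_coef c x) u v = bilin (metric_coef c x) v u;
  metric_pos : forall c x u, chart_image c x -> u != 0 ->
    0 < bilin (metric_coef c x) u u;
  metric_hermitian : forall c x u v, chart_image c x ->
    bilin (metric_coef c x) (stdJ u) (stdJ v) = bilin (metric_coef c x) u v }.

(* fundamental form g(J u, v) *)
Definition fundamental (R : realType) (n : nat) (G : 'M[R]_(n + n))
    (u v : 'rV[R]_(n + n)) : R := bilin G (stdJ u) v.

(* a^sharp: the vector with g(a^sharp, v) = a(v) *)
Definition sharp (R : realType) (m : nat) (G : 'M[R]_m) (a : 'rV[R]_m) :
  'rV[R]_m := a *m invmx G.

Definition closed_form (R : realType) (n : nat) (M : complexManifold R n)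
    (a : oneForm M) : Prop :=
  forall c x u v, chart_image c x ->
    'D_u (fun y => pairing (a c y) v) x - 'D_v (fun y => pairing (a c y) u) x = 0.

Definition exact_form (R : realType) (n : nat) (M : complexManifold R n)
    (a : oneForm M) : Prop :=
  exists h : M -> R, smooth_fun h /\
    forall c x v, chart_image c x ->
      'D_v (h \o chart_inv M c) x = pairing (a c x) v.

(* (d w)(u, v, z) at x, for a 2-form w on an open set of R^m *)
Definition ext_d2 (R : realType) (m : nat)
    (w : 'rV[R]_m -> 'rV[R]_m -> 'rV[R]_m -> R) (x u v z : 'rV[R]_m) : R :=
  'D_u (fun y => w y v z) x - 'D_v (fun y => w y u z) x
  + 'D_z (fun y => w y u v) x.

Definition wedge12 (R : realType) (m : nat) (a : 'rV[R]_m -> R)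
    (w : 'rV[R]_m -> 'rV[R]_m -> R) (u v z : 'rV[R]_m) : R :=
  a u * w v z - a v * w u z + a z * w u v.

(* g is lcK with Lee form theta *)
Definition lcK (R : realType) (n : nat) (M : complexManifold R n)
    (g : hermitianMetric M) (theta : oneForm M) : Prop :=
  closed_form theta /\
  forall c x u v z, chart_image c x ->
    ext_d2 (fun y => fundamental (g c y)) x u v z =
    wedge12 (pairing (theta c x)) (fundamental (g c x)) u v z.

Definition globally_conformally_kaehler (R : realType) (n : nat)
    (M : complexManifold R n) (g : hermitianMetric M) (theta : oneForm M) : Prop :=
  lcK g theta /\ exact_form theta.

Definition vfield (R : realType) (n : nat) := 'rV[R]_(n + n) -> 'rV[R]_(n + n).

Definition bracket (R : realType) (n : nat) (X Y : vfield R n) : vfield R n :=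
  fun x => 'D_(X x) Y x - 'D_(Y x) X x.

(* Operators on vector fields over an open set U; vector fields are total
   functions, only their restrictions to U matter. *)
Definition affine_connection (R : realType) (n : nat) (U : set 'rV[R]_(n + n))
    (nabla : vfield R n -> vfield R n -> vfield R n) : Prop :=
  [/\ forall X Y : vfield R n, smooth U X -> smooth U Y -> smooth U (nabla X Y),
      forall (h : 'rV[R]_(n + n) -> R) (X X' Y : vfield R n),
        smooth U h -> smooth U X -> smooth U X' -> smooth U Y ->
        forall x, U x ->
        nabla (fun y => h y *: X y + X' y) Y x = h x *: nabla X Y x + nabla X' Y x,
      forall X Y Y' : vfield R n, smooth U X -> smooth U Y -> smooth U Y' ->
        forall x, U x ->
        nabla X (fun y => Y y + Y' y) x = nabla X Y x + nabla X Y' x &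
      forall (h : 'rV[R]_(n + n) -> R) (X Y : vfield R n),
        smooth U h -> smooth U X -> smooth U Y ->
        forall x, U x ->
        nabla X (fun y => h y *: Y y) x = 'D_(X x) h x *: Y x + h x *: nabla X Y x].

(* nabla c is the Levi-Civita connection of g on the image of the chart c;
   agreement on overlaps follows from uniqueness. *)
Definition levi_civita (R : realType) (n : nat) (M : complexManifold R n)
    (g : hermitianMetric M)
    (nabla : chart_index M -> vfield R n -> vfield R n -> vfield R n) : Prop :=
  forall c,
  [/\ affine_connection (chart_image c) (nabla c),
      forall X Y : vfield R n,
        smooth (chart_image c) X -> smooth (chart_image c) Y ->
        forall x, chart_image c x ->
        nabla c X Y x - nabla c Y X x = bracket X Y x &
      forall X Y Z : vfield R n, smooth (chart_image c) X ->
        smooth (chart_image c) Y -> smooth (chart_image c) Z ->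
        forall x, chart_image c x ->
        'D_(X x) (fun y => bilin (g c y) (Y y) (Z y)) x =
        bilin (g c x) (nabla c X Y x) (Z x) + bilin (g c x) (Y x) (nabla c X Z x)].

(* The Gauduchon connection of parameter t of an lcK metric with Lee form th,
   in a chart where the metric is g and its Levi-Civita connection is nabla. *)
Definition gauduchon (R : realType) (n : nat) (t : R)
    (g : 'rV[R]_(n + n) -> 'M[R]_(n + n)) (th : 'rV[R]_(n + n) -> 'rV[R]_(n + n))
    (nabla : vfield R n -> vfield R n -> vfield R n) (X Y : vfield R n) :
    vfield R n :=
  fun x =>
    let J := @stdJ R n in
    let theta := pairing (th x) in
    let thetas := sharp (g x) (th x) in
    nabla X Y x
    - (t / 2 * theta (J (X x))) *: J (Y x)
    + ((t - 1) / 4 * theta (J (Y x))) *: J (X x)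
    + ((t - 1) / 4 * fundamental (g x) (X x) (Y x)) *: J thetas
    - ((t + 1) / 4 * theta (Y x)) *: X x
    + ((t + 1) / 4 * bilin (g x) (X x) (Y x)) *: thetas.

Definition curvature (R : realType) (n : nat)
    (nabla : vfield R n -> vfield R n -> vfield R n) (X Y Z : vfield R n) :
    vfield R n :=
  fun x => nabla X (nabla Y Z) x - nabla Y (nabla X Z) x
           - nabla (bracket X Y) Z x.

Definition orthonormal_basis (R : realType) (m : nat) (G : 'M[R]_m)
    (e : 'I_m -> 'rV[R]_m) : Prop :=
  forall i j, bilin G (e i) (e j) = (i == j)%:R.

(* Ric^{t,1}(u, v) at x, computed in the chart c with the orthonormal basis e of
   the tangent space. The curvature is tensorial, so tangent vectors are
   extended to constant vector fields of the chart. *)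
Definition gauduchon_ricci1 (R : realType) (n : nat) (M : complexManifold R n)
    (t : R) (g : hermitianMetric M) (theta : oneForm M)
    (nabla : chart_index M -> vfield R n -> vfield R n -> vfield R n)
    (c : chart_index M) (x : 'rV[R]_(n + n))
    (e : 'I_(n + n) -> 'rV[R]_(n + n)) (u v : 'rV[R]_(n + n)) : R :=
  - 2^-1 * \sum_i
    bilin (g c x)
      (curvature (gauduchon t (g c) (theta c) (nabla c)) (cst u) (cst v) (cst (e i)) x)
      (stdJ (e i)).

(* Main.v *)
Require Import Defs.
From HB Require Import structures.
From mathcomp Require Import all_boot all_order all_algebra.
From mathcomp Require Import all_classical all_reals all_analysis.
From mathcomp Require Import ring lra.

Set Implicit Arguments.
Unset Strict Implicit.
Unset Printing Implicit Defensive.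

Import Order.TTheory GRing.Theory Num.Theory.
Import numFieldNormedType.Exports.

Local Open Scope classical_set_scope.
Local Open Scope ring_scope.

(* In a chart the complex structure J is constant, and the Gauduchon connection of an
   lcK metric preserves it (Koszul formula and d omega = theta /\ omega).  Hence its
   connection matrices Gamma_u commute with J, and the first Ricci form is half the
   exterior derivative of the 1-form u |-> tr (Gamma_u J); in particular it is closed.
   If it equals f omega, then (df + f theta) /\ omega = 0, that is df = - f theta, as n >= 2.
   By Gronwall's lemma along segments the zero set of f is open, and it is closed, so f
   vanishes identically or nowhere.  In the latter case theta = - d ln |f|. *)

(** * Functions of class C^k *)

Lemma near_eq_differentiable (R : realType) (V W : normedModType R)
    (f g : V -> W) (x : V) :
  {near x, f =1 g} -> differentiable f x -> differentiable g x.
Proof.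
move=> fg df; have fgx : f x = g x := nbhs_singleton fg.
have [dfc dfE] := (diff_locallyP _ _).1 df.
have dgE : g \o shift x = cst (g x) + 'd f x +o_ 0 id.
  apply/eqaddoP => e e0; have /eqaddoP/(_ e e0) := dfE.
  have : \forall h \near 0, f (h + x) = g (h + x).
    by move: fg; rewrite (near_shift 0) /=; apply: filterS => h; rewrite subr0.
  by apply: filterS2 => h fgh; rewrite /cst !fctE /= fgh fgx.
have dgf := diff_unique dfc dgE.
by apply/diff_locallyP; rewrite dgf.
Qed.

Section Ck_theory.
Context {R : realType} {V : normedModType R}.
Implicit Types (U : set V) (k : nat).

Lemma eq_near_open T U (f g : V -> T) x : open U -> U x ->
  (forall y, U y -> f y = g y) -> \forall y \near x, f y = g y.
Proof. by move=> oU Ux fg; apply: filterS fg _; apply: open_nbhs_nbhs. Qed.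

Lemma eq_derive_open (W : normedModType R) U (f g : V -> W) x v : open U -> U x ->
  (forall y, U y -> f y = g y) -> 'D_v f x = 'D_v g x.
Proof. by move=> oU Ux fg; apply/near_eq_derive/(eq_near_open oU). Qed.

Lemma eq_Ck (W : normedModType R) U k (f g : V -> W) : open U ->
  (forall x, U x -> f x = g x) -> Ck k U f -> Ck k U g.
Proof.
move=> oU; elim: k f g => [|k IH] f g fg /=.
  move=> cf x Ux; have nfg := eq_near_open oU Ux fg.
  have := cf x Ux; rewrite /prop_for /continuous_at (fg x Ux).
  apply: cvg_trans; exact: near_eq_cvg nfg.
move=> [df ck]; split=> [x Ux|v].
  exact: near_eq_differentiable (eq_near_open oU Ux fg) (df x Ux).
by apply: IH (ck v) => x Ux; exact: (eq_derive_open v oU Ux fg).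
Qed.

Lemma CkW (W : normedModType R) U k (f : V -> W) : Ck k.+1 U f -> Ck k U f.
Proof.
elim: k f => [|k IH] f [df ck] /=.
  by move=> x Ux; exact/differentiable_continuous/df.
by split=> // v; exact/IH/ck.
Qed.

Lemma Ck_continuous (W : normedModType R) U k (f : V -> W) x :
  Ck k U f -> U x -> {for x, continuous f}.
Proof. by elim: k => [/(_ x)//|k IH /CkW]. Qed.

Lemma Ck_cst (W : normedModType R) U k (w : W) : Ck k U (cst w : V -> W).
Proof.
elim: k w => [|k IH] w /=; first by move=> x _; exact: cst_continuous.
split=> [x _|v]; first exact: differentiable_cst.
by rewrite (_ : (fun _ => _) = cst 0) //; apply/funext => x; rewrite derive_cst.
Qed.

Lemma CkD (W : normedModType R) U k (f g : V -> W) : open U ->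
  Ck k U f -> Ck k U g -> Ck k U (fun x => f x + g x).
Proof.
move=> oU; elim: k f g => [|k IH] f g /=.
  by move=> cf cg x Ux; apply: continuousD; [exact: cf|exact: cg].
move=> [df cf] [dg cg]; split=> [x Ux|v].
  by apply: differentiableD; [exact: df|exact: dg].
apply: eq_Ck (IH _ _ (cf v) (cg v)) => // x Ux.
by rewrite (@deriveD _ _ _ f g) //; apply: diff_derivable; [exact: df|exact: dg].
Qed.

Lemma Ck_sum (W : normedModType R) U k (I : Type) (r : seq I) (P : pred I)
    (f : I -> V -> W) : open U ->
  (forall i, Ck k U (f i)) -> Ck k U (fun x => \sum_(i <- r | P i) f i x).
Proof.
move=> oU cf; elim: r => [|i r IH].
  by apply: eq_Ck (Ck_cst U k 0) => // x _; rewrite big_nil.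
have [Pi|nPi] := boolP (P i).
  by apply: eq_Ck (CkD oU (cf i) IH) => // x _; rewrite big_cons Pi.
by apply: eq_Ck IH => // x _; rewrite big_cons (negPf nPi).
Qed.

Lemma CkZl (W : normedModType R) U k (f : V -> R) (w : W) : open U ->
  Ck k U f -> Ck k U (fun x => f x *: w).
Proof.
move=> oU; elim: k f => [|k IH] f /=.
  by move=> cf x Ux; apply: continuousZr_tmp; exact: cf.
move=> [df cf]; split=> [x Ux|v]; first by apply: differentiableZl; exact: df.
apply: eq_Ck (IH _ (cf v)) => // x Ux.
rewrite !deriveE ?diffZl//; try exact: df.
by apply: differentiableZl; exact: df.
Qed.

Lemma CkM U k (f g : V -> R) : open U ->
  Ck k U f -> Ck k U g -> Ck k U (fun x => f x * g x).
Proof.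
move=> oU; elim: k f g => [|k IH] f g.
  by move=> cf cg x Ux; apply: continuousM; [exact: cf|exact: cg].
move=> cf1 cg1; case: (cf1) (cg1) => [df cf] [dg cg]; split=> [x Ux|v].
  by apply: differentiableM; [exact: df|exact: dg].
have := CkD oU (IH _ _ (CkW cf1) (cg v)) (IH _ _ (CkW cg1) (cf v)).
apply: eq_Ck => // x Ux.
by rewrite (@deriveM _ _ f g) //; apply: diff_derivable; [exact: df|exact: dg].
Qed.

Lemma Ck_prod U k (I : Type) (r : seq I) (P : pred I) (f : I -> V -> R) :
  open U -> (forall i, Ck k U (f i)) ->
  Ck k U (fun x => \prod_(i <- r | P i) f i x).
Proof.
move=> oU cf; elim: r => [|i r IH].
  by apply: eq_Ck (Ck_cst U k (1 : R)) => // x _; rewrite big_nil.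
have [Pi|nPi] := boolP (P i).
  by apply: eq_Ck (CkM oU (cf i) IH) => // x _; rewrite big_cons Pi.
by apply: eq_Ck IH => // x _; rewrite big_cons (negPf nPi).
Qed.

Lemma CkV U k (f : V -> R) : open U -> (forall x, U x -> f x != 0) ->
  Ck k U f -> Ck k U (fun x => (f x)^-1).
Proof.
move=> oU f0; elim: k => [|k IH].
  by move=> cf x Ux; apply: continuousV; [exact: f0|exact: cf].
move=> cf1; case: (cf1) => [df cf]; split=> [x Ux|v].
  by apply: differentiableV; [exact: df|exact: f0].
have := CkM oU (Ck_cst U k (-1 : R)) (CkM oU (cf v) (CkM oU (IH (CkW cf1)) (IH (CkW cf1)))).
apply: eq_Ck => // x Ux.
rewrite (@deriveV _ _ f) ?f0//; last exact/diff_derivable/df.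
by rewrite /cst /= -[_ *: _]/(_ * _) -exprVn expr2; ring.
Qed.

Lemma Ck_mxE U k m n (f : V -> 'M[R]_(m, n)) : open U ->
  Ck k U f <-> (forall i j, Ck k U (fun x => f x i j)).
Proof.
move=> oU; split.
  elim: k f => [|k IH] f /=.
    move=> cf i j x Ux; apply: (@continuous_comp _ _ _ f (fun M : 'M[R]_(m, n) => M i j)).
      exact: cf.
    exact: coord_continuous.
  move=> [df cf] i j; split=> [x Ux|v].
    apply: (@differentiable_comp _ _ _ _ f (fun M : 'M[R]_(m, n) => M i j)); first exact: df.
    exact: differentiable_coord.
  apply: eq_Ck (IH _ (cf v) i j) => // x Ux.
  by rewrite derive_mx ?mxE//; exact/diff_derivable/df.
move=> cf.
have : Ck k U (fun x => \sum_i \sum_j (f x i j *: delta_mx i j : 'M[R]_(m, n))).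
  by apply: Ck_sum => // i; apply: Ck_sum => // j; apply: CkZl.
by apply: eq_Ck => // x _; rewrite -matrix_sum_delta.
Qed.

End Ck_theory.

(** * Mean value arguments *)

Lemma MVT_closed (R : realType) (f df : R -> R) (a b : R) : a < b ->
  (forall s, a <= s <= b -> is_derive s 1 f (df s)) ->
  exists2 c, a <= c <= b & f b - f a = df c * (b - a).
Proof.
move=> ab dfE; have [c cab fE] : exists2 c, c \in `]a, b[%R & f b - f a = df c * (b - a).
  apply: MVT => //.
    by move=> s; rewrite in_itv/= => /andP[/ltW as_ /ltW sb]; apply: dfE; rewrite as_.
  apply: derivable_within_continuous => s; rewrite in_itv/= => sab.
  by have [] := dfE s sab.
by exists c => //; move: cab; rewrite in_itv/= => /andP[/ltW-> /ltW->].
Qed.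

Lemma linear_ode_eq0 (R : realType) (phi k : R -> R) :
  (forall s : R, 0 <= s <= 1 -> is_derive s 1 phi (phi s * k s)) ->
  {within `[0, 1], continuous k} -> phi 0 = 0 -> phi 1 = 0.
Proof.
move=> dphi ck phi0.
have [c _ kC] := EVT_max ler01 ck; set C := k c in kC.
(* Gronwall: [phi^2 * exp (- 2 C s)] is nonincreasing, where [k <= C]. *)
pose psi (s : R) : R := phi s * phi s * expR (- (2 * C) * s).
pose dpsi (s : R) : R := 2 * (phi s * phi s) * (k s - C) * expR (- (2 * C) * s).
have dpsiE (s : R) : 0 <= s <= 1 -> is_derive s 1 psi (dpsi s).
  move=> s01; have := dphi s s01 => dphis.
  have de : is_derive s 1 (fun s : R => expR (- (2 * C) * s))
      (- (2 * C) * expR (- (2 * C) * s)).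
    have dl : is_derive s 1 (fun s : R => - (2 * C) * s) (- (2 * C)).
      have dZ : is_derive s 1 (- (2 * C) \*: (id : R -> R)) (- (2 * C) *: 1).
        exact: is_deriveZ.
      by move: dZ; rewrite -[_ *: 1]/(_ * 1) mulr1.
    rewrite [- (2 * C) * expR _]mulrC.
    exact: (is_derive1_comp (f := expR) (is_derive_expR _) dl).
  apply: is_derive_eq => //=.
  rewrite -![_ *: _]/(_ * _) /dpsi; ring.
have [s s01 psi01] := MVT_closed ltr01 dpsiE.
have : psi 1 - psi 0 <= 0.
  rewrite psi01 subr0 mulr1 /dpsi mulr_le0_ge0 ?expR_ge0//.
  apply: mulr_ge0_le0; first by rewrite mulr_ge0// -expr2 sqr_ge0.
  by rewrite subr_le0 kC// in_itv.
rewrite {2}/psi phi0 !mul0r subr0 /psi pmulr_lle0 ?expR_gt0// -expr2 => phi1.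
by apply/eqP; rewrite -sqrf_eq0 eq_le phi1 sqr_ge0.
Qed.

Section line.
Context {R : realType} {V : normedModType R}.
Implicit Types (U : set V) (F : V -> R).

Lemma is_derive_line (F : V -> R) (x u : V) (s : R) :
  derivable F (x + s *: u) u ->
  is_derive s 1 (fun r : R => F (x + r *: u)) ('D_u F (x + s *: u)).
Proof.
move=> dF.
have E : (fun h : R => h^-1 *: (((fun r : R => F (x + r *: u)) \o shift s) (h *: 1)
              - F (x + s *: u))) =
         (fun h : R => h^-1 *: ((F \o shift (x + s *: u)) (h *: u) - F (x + s *: u))).
  apply/funext => h /=; congr (_ *: (F _ - _)).
  by rewrite -[h *: 1]/(h * 1) mulr1 scalerDl addrCA.
by split; [rewrite /derivable E|rewrite /derive E].
Qed.

Lemma second_difference U F (x u v : V) (h : R) : Ck 2 U F -> 0 < h ->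
  (forall a b : R, 0 <= a <= h -> 0 <= b <= h -> U (x + a *: u + b *: v)) ->
  exists a b : R, [/\ 0 <= a <= h, 0 <= b <= h &
    F (x + h *: u + h *: v) - F (x + h *: v) - (F (x + h *: u) - F x) =
    'D_v ('D_u F) (x + a *: u + b *: v) * h * h].
Proof.
move=> [dF /(_ u)[dDF _]] h0 Uh.
have h00 : 0 <= (0 : R) <= h by rewrite lexx ltW.
have hh : 0 <= h <= h by rewrite lexx ltW.
pose phi (s : R) := F (x + h *: v + s *: u) - F (x + s *: u).
pose dphi (s : R) := 'D_u F (x + h *: v + s *: u) - 'D_u F (x + s *: u).
have dphiE (s : R) : 0 <= s <= h -> is_derive s 1 phi (dphi s).
  move=> s0h; apply: is_deriveB; apply: is_derive_line; apply: diff_derivable; apply: dF.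
    by rewrite addrAC; exact: Uh.
  by have := Uh _ _ s0h h00; rewrite scale0r addr0.
have [a a0h phiE] := MVT_closed h0 dphiE.
pose psi (r : R) := 'D_u F (x + a *: u + r *: v).
have dpsiE (r : R) : 0 <= r <= h ->
    is_derive r 1 psi ('D_v ('D_u F) (x + a *: u + r *: v)).
  by move=> r0h; apply/is_derive_line/diff_derivable/dDF/Uh.
have [b b0h psiE] := MVT_closed h0 dpsiE.
exists a, b; split=> //; move: phiE psiE.
rewrite /phi /dphi /psi !subr0 !scale0r !addr0 => phiE psiE.
have -> : F (x + h *: u + h *: v) = F (x + h *: v + h *: u) by rewrite addrAC.
rewrite -psiE (addrAC x (a *: u)) -phiE; ring.
Qed.

Lemma derive_comm U F (x u v : V) : open U -> U x -> Ck 2 U F ->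
  'D_u ('D_v F) x = 'D_v ('D_u F) x.
Proof.
move=> oU Ux cF; apply/eqP/negPn/negP; rewrite -subr_eq0 -normr_gt0.
set d := `|_| => d0.
have cont w z : {for x, continuous ('D_w ('D_z F))}.
  have [_ /(_ z)[_ /(_ w)]] := cF; exact.
have near1 w z : \forall y \near x, `|'D_w ('D_z F) x - 'D_w ('D_z F) y| < d / 2.
  by have /cvgrPdist_lt/(_ (d / 2)) := cont w z; apply; rewrite divr_gt0.
have : \forall y \near x, [/\ U y, `|'D_u ('D_v F) x - 'D_u ('D_v F) y| < d / 2 &
    `|'D_v ('D_u F) x - 'D_v ('D_u F) y| < d / 2].
  by apply: filterS3 (open_nbhs_nbhs (conj oU Ux)) (near1 u v) (near1 v u) => y.
move=> /nbhs_ballP[e /= e0 eN].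
pose h := e / (`|u| + `|v| + 1).
have D0 : 0 < `|u| + `|v| + 1 by rewrite ltr_wpDl// addr_ge0.
have h0 : 0 < h by rewrite divr_gt0.
have inN (a b : R) : 0 <= a <= h -> 0 <= b <= h -> ball x e (x + a *: u + b *: v).
  move=> /andP[a0 ah] /andP[b0 bh]; rewrite -ball_normE /ball_ /= -addrA opprD addrA subrr.
  rewrite sub0r normrN (le_lt_trans (ler_normD _ _))// !normrZ (ger0_norm a0) (ger0_norm b0).
  have : h * (`|u| + `|v| + 1) = e by rewrite /h -mulrA mulVf ?mulr1// gt_eqF.
  have := ler_wpM2r (normr_ge0 u) ah; have := ler_wpM2r (normr_ge0 v) bh; lra.
have inN' (a b : R) : 0 <= a <= h -> 0 <= b <= h -> ball x e (x + a *: v + b *: u).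
  by move=> ah bh; rewrite addrAC; exact: inN.
have [a [b [ah bh E1]]] : exists a b, [/\ 0 <= a <= h, 0 <= b <= h & _] :=
  second_difference cF h0 (fun a b ah bh => let: And3 Uy _ _ := eN _ (inN a b ah bh) in Uy).
have [a' [b' [ah' bh' E2]]] : exists a b, [/\ 0 <= a <= h, 0 <= b <= h & _] :=
  second_difference cF h0 (fun a b ah bh => let: And3 Uy _ _ := eN _ (inN' a b ah bh) in Uy).
have E : 'D_v ('D_u F) (x + a *: u + b *: v) = 'D_u ('D_v F) (x + a' *: v + b' *: u).
  apply: (mulIf (lt0r_neq0 h0)); apply: (mulIf (lt0r_neq0 h0)).
  apply: etrans (esym E1) _; apply: etrans _ E2; rewrite (addrAC x (h *: v)).
  by move: (F _) (F _) (F _) (F _) => *; ring.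
have [_ _ l1] := eN _ (inN _ _ ah bh); have [_ l2 _] := eN _ (inN' _ _ ah' bh').
rewrite E distrC in l1.
have l3 : d <= _ + _ :=
  ler_distD ('D_u ('D_v F) (x + a' *: v + b' *: u)) ('D_u ('D_v F) x) ('D_v ('D_u F) x).
have := le_lt_trans l3 (ltrD l2 l1).
by rewrite -splitr ltxx.
Qed.

Lemma linear_pde_eq0 (U : set V) F (a : V -> V -> R) (x0 : V) (e : R) :
  ball x0 e `<=` U ->
  (forall y v, U y -> derivable F y v /\ 'D_v F y = F y * a y v) ->
  (forall y v, U y -> {for y, continuous (fun z => a z v)}) ->
  F x0 = 0 -> forall y, ball x0 e y -> F y = 0.
Proof.
move=> BU dF ca F0 y By; pose v := y - x0.
have inU (s : R) : 0 <= s <= 1 -> U (x0 + s *: v).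
  move=> /andP[s0 s1]; apply: BU; rewrite -ball_normE /ball_ /= opprD addrA subrr sub0r.
  rewrite normrN normrZ (ger0_norm s0).
  move: By; rewrite -ball_normE /ball_/= distrC -/v => ve.
  by apply: le_lt_trans ve; rewrite ler_piMl.
pose phi (s : R) := F (x0 + s *: v); pose k (s : R) := a (x0 + s *: v) v.
have dphi (s : R) : 0 <= s <= 1 -> is_derive s 1 phi (phi s * k s).
  by move=> /inU Us; have [d <-] := dF _ v Us; exact: is_derive_line.
have ck : {within `[0, 1], continuous k}.
  apply: continuous_in_subspaceT => s; rewrite inE/= in_itv/= => s01.
  apply: (@continuous_comp _ _ _ (fun s : R => x0 + s *: v) (fun z => a z v)).
    by apply: continuousD; [exact: cst_continuous|apply: continuousZr_tmp; exact: cvg_id].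
  by apply: ca; exact: inU.
have phi0 : phi 0 = 0 by rewrite /phi scale0r addr0.
have := linear_ode_eq0 dphi ck phi0; rewrite /phi.
by rewrite scale1r /v addrC subrK.
Qed.

End line.

(** * Matrices and Hermitian linear algebra *)

Section Ck_matrix.
Context {R : realType} {V : normedModType R}.
Implicit Types (U : set V) (k : nat).

Lemma Ck_mulmx U k m n p (A : V -> 'M[R]_(m, n)) (B : V -> 'M[R]_(n, p)) :
  open U -> Ck k U A -> Ck k U B -> Ck k U (fun x => A x *m B x).
Proof.
move=> oU /(Ck_mxE _ _ oU) cA /(Ck_mxE _ _ oU) cB; apply/(Ck_mxE _ _ oU) => i j.
have : Ck k U (fun x => \sum_l A x i l * B x l j).
  by apply: Ck_sum => // l; exact: CkM.
by apply: eq_Ck => // x _; rewrite mxE.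
Qed.

Lemma Ck_trmx U k m n (A : V -> 'M[R]_(m, n)) :
  open U -> Ck k U A -> Ck k U (fun x => (A x)^T).
Proof.
move=> oU /(Ck_mxE _ _ oU) cA; apply/(Ck_mxE _ _ oU) => i j.
by apply: eq_Ck (cA j i) => // x _; rewrite mxE.
Qed.

Lemma Ck_scale U k m n (a : V -> R) (A : V -> 'M[R]_(m, n)) :
  open U -> Ck k U a -> Ck k U A -> Ck k U (fun x => a x *: A x).
Proof.
move=> oU ca /(Ck_mxE _ _ oU) cA; apply/(Ck_mxE _ _ oU) => i j.
by apply: eq_Ck (CkM oU ca (cA i j)) => // x _; rewrite mxE.
Qed.

Lemma Ck_det U k m (A : V -> 'M[R]_m) :
  open U -> Ck k U A -> Ck k U (fun x => \det (A x)).
Proof.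
move=> oU /(Ck_mxE _ _ oU) cA; apply: Ck_sum => // s.
by apply: CkM => //; [exact: Ck_cst|exact: Ck_prod].
Qed.

Lemma Ck_invmx U k m (A : V -> 'M[R]_m) : open U ->
  (forall x, U x -> A x \in unitmx) -> Ck k U A -> Ck k U (fun x => invmx (A x)).
Proof.
move=> oU uA cA.
have cadj : Ck k U (fun x => \adj (A x)).
  apply/(Ck_mxE _ _ oU) => i j.
  have cc : Ck k U (fun x => (-1) ^+ (j + i) * \det (row' j (col' i (A x)))).
    apply: CkM => //; first exact: Ck_cst.
    apply: Ck_det => //; apply/(Ck_mxE _ _ oU) => i' j'.
    by apply: eq_Ck ((Ck_mxE k A oU).1 cA (lift j i') (lift i j')) => // x _; rewrite !mxE.
  by apply: eq_Ck cc => // x _; rewrite mxE.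
have cdet : Ck k U (fun x => (\det (A x))^-1).
  apply: CkV => //; last exact: Ck_det.
  by move=> x /uA; rewrite unitmxE unitfE.
by apply: eq_Ck (Ck_scale oU cdet cadj) => // x Ux; rewrite /invmx uA.
Qed.

End Ck_matrix.

Section linear_algebra.
Context {R : realType}.

Lemma bilinDl m (G : 'M[R]_m) u u' v : bilin G (u + u') v = bilin G u v + bilin G u' v.
Proof. by rewrite /bilin !mulmxDl mxE. Qed.

Lemma bilinDr m (G : 'M[R]_m) u v v' : bilin G u (v + v') = bilin G u v + bilin G u v'.
Proof. by rewrite /bilin linearD mulmxDr mxE. Qed.

Lemma bilinZl m (G : 'M[R]_m) a u v : bilin G (a *: u) v = a * bilin G u v.
Proof. by rewrite /bilin -!scalemxAl mxE. Qed.

Lemma bilinZr m (G : 'M[R]_m) a u v : bilin G u (a *: v) = a * bilin G u v.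
Proof. by rewrite /bilin linearZ -scalemxAr mxE. Qed.

Lemma bilinNl m (G : 'M[R]_m) u v : bilin G (- u) v = - bilin G u v.
Proof. by rewrite -scaleN1r bilinZl mulN1r. Qed.

Lemma bilinNr m (G : 'M[R]_m) u v : bilin G u (- v) = - bilin G u v.
Proof. by rewrite -scaleN1r bilinZr mulN1r. Qed.

Lemma bilin_sharp m (G : 'M[R]_m) a v : G \in unitmx -> bilin G (sharp G a) v = pairing a v.
Proof. by move=> uG; rewrite /bilin /sharp mulmxKV. Qed.

Lemma pairingN m (a v : 'rV[R]_m) : pairing a (- v) = - pairing a v.
Proof. by rewrite /pairing linearN mulmxN mxE. Qed.

Lemma bilin_inj m (G : 'M[R]_m) (x y : 'rV[R]_m) :
  (forall u, u != 0 -> 0 < bilin G u u) ->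
  (forall w, bilin G x w = bilin G y w) -> x = y.
Proof.
move=> pG xy; apply/eqP/negPn/negP; rewrite -subr_eq0 => /pG.
by rewrite bilinDl bilinNl xy subrr ltxx.
Qed.

Lemma bilin_delta m (G : 'M[R]_m) i j : bilin G (delta_mx 0 i) (delta_mx 0 j) = G i j.
Proof. by rewrite /bilin trmx_delta -rowE -colE !mxE. Qed.

Lemma bilin_trmx m (G : 'M[R]_m) :
  (forall u v, bilin G u v = bilin G v u) -> G^T = G.
Proof.
move=> sG; apply/matrixP => i j; rewrite mxE.
by have := sG (delta_mx 0 j) (delta_mx 0 i); rewrite !bilin_delta.
Qed.

Lemma orthonormal_matrix m (G : 'M[R]_m) : G^T = G ->
  (forall u, u != 0 -> 0 < bilin G u u) -> exists E : 'M[R]_m, E *m G *m E^T = 1%:M.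
Proof.
elim: m G => [|m IH]; first by move=> G _ _; exists 0; apply/matrixP => -[].
rewrite -[m.+1]/(1 + m)%N => G sG pG.
have [a [b [D GE]]] : exists a b D, G = block_mx a b b^T D.
  by exists (ulsubmx G), (ursubmx G), (drsubmx G); rewrite trmx_ursub sG submxK.
have sD : D^T = D.
  by move: sG; rewrite GE tr_block_mx => /eq_block_mx[].
pose al := a 0 0; have aE : a = al%:M by rewrite [a]mx11_scalar.
have al0 : 0 < al.
  have : 0 < bilin G (row_mx 1 0) (row_mx 1 0).
    apply: pG; apply/eqP => /matrixP/(_ 0 (lshift m 0)).
    by rewrite row_mxEl !mxE eqxx => /eqP; rewrite oner_eq0.
  rewrite /bilin GE mul_row_block tr_row_mx mul_row_col !mul1mx !mul0mx !addr0.
  by rewrite trmx1 trmx0 mulmx0 mulmx1 addr0.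
pose S := D - al^-1 *: (b^T *m b).
have [E' E'S] : exists E' : 'M[R]_m, E' *m S *m E'^T = 1%:M.
  apply: IH.
    by rewrite /S linearB linearZ /= trmx_mul trmxK sD.
  move=> w w0; pose c := - al^-1 *: (w *m b^T).
  have : 0 < bilin G (row_mx c w) (row_mx c w).
    apply: pG; apply/eqP => /(congr1 rsubmx); rewrite row_mxKr linear0.
    by apply/eqP.
  suff -> : bilin G (row_mx c w) (row_mx c w) = bilin S w w by [].
  have cab : c *m a + w *m b^T = 0.
    by rewrite /c aE mul_mx_scalar scalerA mulrN mulfV ?gt_eqF// scaleN1r addNr.
  rewrite /bilin GE mul_row_block tr_row_mx mul_row_col cab mul0mx add0r.
  congr (_ 0 0); congr (_ *m _); rewrite /S mulmxBr -scalemxAr /c -scalemxAl mulmxA.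
  by rewrite scaleNr addrC.
pose s := (Num.sqrt al)^-1.
exists (block_mx s%:M 0 (- al^-1 *: (E' *m b^T)) E').
have s2 : s * al * s = 1.
  rewrite /s mulrAC -expr2 exprVn sqr_sqrtr ?ltW// mulVf//.
  by rewrite gt_eqF.
have cab : (- al^-1 *: (E' *m b^T)) *m a + E' *m b^T = 0.
  by rewrite aE mul_mx_scalar scalerA mulrN mulfV ?gt_eqF// scaleN1r addNr.
have cbD : (- al^-1 *: (E' *m b^T)) *m b + E' *m D = E' *m S.
  by rewrite /S mulmxBr -scalemxAr -scalemxAl mulmxA scaleNr addrC.
rewrite GE tr_block_mx !mulmx_block cab cbD !mul0mx !addr0 trmx0 !mulmx0 !addr0 ?add0r.
rewrite E'S tr_scalar_mx aE -!scalar_mxM s2 [RHS]scalar_mx_block.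
congr block_mx; rewrite linearZ /= trmx_mul trmxK.
rewrite !mul_scalar_mx -scalemxAl scalerA.
by rewrite mulrN mulfK ?gt_eqF// scaleNr addNr.
Qed.

Lemma orthonormal_unitmx m (G E : 'M[R]_m) : E *m G *m E^T = 1%:M -> G \in unitmx.
Proof.
move=> EG; have : \det (E *m G *m E^T) \is a GRing.unit by rewrite EG det1 unitr1.
by rewrite !det_mulmx !unitrM -unitmxE => /andP[/andP[]].
Qed.

Definition Jmx n : 'M[R]_(n + n) := block_mx 0 1%:M (- 1%:M) 0.

Lemma stdJE n (v : 'rV[R]_(n + n)) : stdJ v = v *m Jmx n.
Proof.
by rewrite /stdJ -{3}(hsubmxK v) mul_row_block !mulmx0 mulmxN !mulmx1 addr0 add0r.
Qed.

Lemma JmxK n : Jmx n *m Jmx n = - 1%:M.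
Proof.
have E k : - 1%:M = (-1)%:M :> 'M[R]_k by rewrite raddfN.
rewrite /Jmx mulmx_block !mulmx0 !mul0mx !mulmx1 !mul1mx !addr0 !add0r !E.
by rewrite -scalar_mx_block.
Qed.

Lemma stdJK n (v : 'rV[R]_(n + n)) : stdJ (stdJ v) = - v.
Proof. by rewrite !stdJE -mulmxA JmxK mulmxN mulmx1. Qed.

Lemma stdJD n (u v : 'rV[R]_(n + n)) : stdJ (u + v) = stdJ u + stdJ v.
Proof. by rewrite !stdJE mulmxDl. Qed.

Lemma stdJZ n a (v : 'rV[R]_(n + n)) : stdJ (a *: v) = a *: stdJ v.
Proof. by rewrite !stdJE scalemxAl. Qed.

Lemma bilin_Jskew n (G : 'M[R]_(n + n)) u v :
  (forall u v, bilin G (stdJ u) (stdJ v) = bilin G u v) ->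
  bilin G (stdJ u) v = - bilin G u (stdJ v).
Proof. by move=> hG; rewrite -[bilin G (stdJ u) v]hG stdJK bilinNl. Qed.

Lemma Jmx_hermitian n (G : 'M[R]_(n + n)) :
  (forall u v, bilin G (stdJ u) (stdJ v) = bilin G u v) ->
  G *m (Jmx n)^T = - (Jmx n *m G).
Proof.
move=> hG; have : Jmx n *m G *m (Jmx n)^T = G.
  apply/matrixP => i j.
  by rewrite -[RHS]bilin_delta -hG !stdJE -bilin_delta /bilin trmx_mul !mulmxA.
move=> /(congr1 (mulmx (Jmx n))); rewrite !mulmxA JmxK mulNmx mul1mx mulNmx => <-.
by rewrite opprK.
Qed.

Lemma bilin_row m p q (G : 'M[R]_m) (A : 'M[R]_(p, m)) (B : 'M[R]_(q, m)) i j :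
  bilin G (row i A) (row j B) = (A *m G *m B^T) i j.
Proof.
rewrite /bilin -row_mul tr_row; move: (A *m G) B^T => X Y.
by rewrite !mxE; apply: eq_bigr => k _; rewrite !mxE.
Qed.

Lemma trace_orthonormal n (G E K : 'M[R]_(n + n)) :
  (forall u v, bilin G (stdJ u) (stdJ v) = bilin G u v) ->
  E *m G *m E^T = 1%:M ->
  \sum_i bilin G (row i E *m K) (stdJ (row i E)) = - \tr (K *m Jmx n).
Proof.
move=> hG EG; transitivity (\tr (E *m (K *m G *m (Jmx n)^T *m E^T))).
  by apply: eq_bigr => i _; rewrite stdJE -!row_mul bilin_row trmx_mul !mulmxA.
rewrite mxtrace_mulC -(mulmxA K) (Jmx_hermitian hG) -!mulmxA.
have -> : E^T *m E = invmx G.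
  have uG := orthonormal_unitmx EG.
  have : G *m E^T *m E = 1%:M by apply: mulmx1C; rewrite mulmxA.
  by rewrite -mulmxA => /(congr1 (mulmx (invmx G))); rewrite mulKmx// mulmx1.
by rewrite mulNmx mulmxN raddfN /= -mulmxA mulmxV ?mulmx1// (orthonormal_unitmx EG).
Qed.

Lemma trace_commutator n (A B J : 'M[R]_n) :
  A *m J = J *m A -> \tr ((B *m A - A *m B) *m J) = 0.
Proof.
move=> AJ; rewrite mulmxBl linearB /= -(mulmxA B) AJ mulmxA.
by rewrite [X in X - _]mxtrace_mulC mulmxA subrr.
Qed.

(* Take [v] orthogonal to [u] and [J u], and evaluate on [u, v, J v]. *)
Lemma wedge_fundamental_inj n (G : 'M[R]_(n + n)) (b : 'rV[R]_(n + n) -> R) :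
  (2 <= n)%N ->
  (forall u, u != 0 -> 0 < bilin G u u) ->
  (forall u v, bilin G u v = bilin G v u) ->
  (forall u v, bilin G (stdJ u) (stdJ v) = bilin G u v) ->
  (forall u v z, wedge12 b (fundamental G) u v z = 0) ->
  forall u, b u = 0.
Proof.
move=> n2 pG sG hG bG u.
pose A : 'M[R]_(n + n, 1 + 1) := row_mx (stdJ u *m G)^T (u *m G)^T.
have kA0 : kermx A != 0.
  rewrite -mxrank_eq0 mxrank_ker subn_eq0 -ltnNge.
  by rewrite (leq_ltn_trans (rank_leq_col A))// (leq_trans _ (leq_add n2 n2)).
pose v := nz_row (kermx A).
have v0 : v != 0 by rewrite nz_row_eq0.
have /sub_kermxP : (v <= kermx A)%MS := nz_row_sub _.
rewrite mul_mx_row -[0](row_mx0 _ _ 1 1) => /eq_row_mx[/(congr1 trmx) E1 /(congr1 trmx) E2].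
move: E1 E2; rewrite !trmx_mul !trmxK trmx0 => E1 E2.
have uv : bilin G (stdJ u) v = 0 by rewrite /bilin E1 mxE.
have uJv : bilin G (stdJ u) (stdJ v) = 0 by rewrite hG /bilin E2 mxE.
have := bG u v (stdJ v); rewrite /wedge12 /fundamental uv uJv hG !mulr0 subr0 addr0.
by move/eqP; rewrite mulf_eq0 (gt_eqF (pG v v0)) orbF => /eqP.
Qed.

End linear_algebra.

(** * The Gauduchon connection in a chart *)

Section derive_linear.
Context {R : realType} {V : normedModType R}.

Lemma derive_scalel (W : normedModType R) (c : V -> R) (w : W) (x v : V) :
  differentiable c x -> 'D_v (fun y => c y *: w) x = 'D_v c x *: w.
Proof. by move=> dc; rewrite !deriveE ?diffZl//; exact: differentiableZl. Qed.

Lemma derive_linear m p (W : normedModType R) (L : {linear 'M[R]_(m, p) -> W})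
    (A : V -> 'M[R]_(m, p)) (x v : V) :
  differentiable A x -> 'D_v (fun y => L (A y)) x = L ('D_v A x).
Proof.
move=> dA.
have dAij i j : differentiable (fun y => A y i j) x.
  apply: (@differentiable_comp _ _ _ _ A (fun M : 'M[R]_(m, p) => M i j)) => //.
  exact: differentiable_coord.
have -> : (fun y => L (A y)) =
    \sum_i \sum_j (fun y => A y i j *: L (delta_mx i j)).
  apply/funext => y; rewrite {1}(matrix_sum_delta (A y)) linear_sum fct_sumE.
  apply: eq_bigr => i _; rewrite linear_sum fct_sumE; apply: eq_bigr => j _.
  by rewrite linearZ.
have dZ i j : derivable (fun y => A y i j *: L (delta_mx i j)) x v.
  by apply: diff_derivable; apply: differentiableZl.
rewrite derive_sum => [|i]; last exact: derivable_sum.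
rewrite derive_mx; last exact: diff_derivable.
rewrite [X in L X]matrix_sum_delta linear_sum; apply: eq_bigr => i _.
rewrite derive_sum // linear_sum; apply: eq_bigr => j _.
by rewrite linearZ mxE derive_scalel.
Qed.

End derive_linear.

(* [dd] stands for the second derivatives of a primitive of [F om], [dw] for the first
   derivatives of [om]. *)
Lemma closed_multiple_wedge (T : Type) (R : realType) (F : R) (dF th : T -> R)
    (om : T -> T -> R) (dw dd : T -> T -> T -> R) :
  (forall b c d, dd b c d = dd c b d) ->
  (forall z b c, 2^-1 * (dd z b c - dd z c b) = F * dw z b c + dF z * om b c) ->
  (forall u v z, dw u v z - dw v u z + dw z u v =
     th u * om v z - th v * om u z + th z * om u v) ->
  forall u v z, (dF u + F * th u) * om v z - (dF v + F * th v) * om u z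
    + (dF z + F * th z) * om u v = 0.
Proof.
move=> ddC Fom dom u v z.
have := Fom u v z; have := Fom v u z; have := Fom z u v; have := dom u v z.
rewrite (ddC v u) (ddC z u) (ddC z v) => H1 H2 H3 H4.
have : F * (dw u v z - dw v u z + dw z u v) +
    (dF u * om v z - dF v * om u z + dF z * om u v) = 0.
  transitivity (2^-1 * (dd u v z - dd u z v) - 2^-1 * (dd u v z - dd v z u) +
    2^-1 * (dd u z v - dd v z u)); last by ring.
  by rewrite H2 H3 H4; ring.
by rewrite H1 => <-; ring.
Qed.

Section chart.
Context {R : realType} {n : nat} (U : set 'rV[R]_(n + n)) (oU : open U).

Lemma Ck_stdJ k (X : vfield R n) : Ck k U X -> Ck k U (fun y => stdJ (X y)).
Proof.
move=> cX; apply: eq_Ck (Ck_mulmx oU cX (Ck_cst U k (Jmx n))) => // x _.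
by rewrite stdJE.
Qed.

Lemma Ck_pairing k (a X : vfield R n) :
  Ck k U a -> Ck k U X -> Ck k U (fun y => pairing (a y) (X y)).
Proof.
by move=> ca cX; exact: (Ck_mxE _ _ oU).1 (Ck_mulmx oU ca (Ck_trmx oU cX)) 0 0.
Qed.

Lemma Ck_bilin k (G : 'rV[R]_(n + n) -> 'M[R]_(n + n)) (X Y : vfield R n) :
  Ck k U G -> Ck k U X -> Ck k U Y -> Ck k U (fun y => bilin (G y) (X y) (Y y)).
Proof.
move=> cG cX cY.
exact: (Ck_mxE _ _ oU).1 (Ck_mulmx oU (Ck_mulmx oU cX cG) (Ck_trmx oU cY)) 0 0.
Qed.

Lemma smooth_cst (W : normedModType R) (w : W) : smooth U (cst w : 'rV[R]_(n + n) -> W).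
Proof. by move=> k; exact: Ck_cst. Qed.

Section connection.
Context (D : vfield R n -> vfield R n -> vfield R n) (affD : affine_connection U D).

Lemma connection0l (Y : vfield R n) x : smooth U Y -> U x -> D (cst 0) Y x = 0.
Proof.
case: affD => _ linD _ _ sY Ux.
have := linD (cst (-1)) (cst 0) (cst 0) Y (smooth_cst _) (smooth_cst _) (smooth_cst _) sY x Ux.
rewrite (_ : (fun y => _) = cst 0); last by apply/funext => y; rewrite /cst scaler0 addr0.
by move->; rewrite /cst scaleN1r addNr.
Qed.

Lemma connection0r (X : vfield R n) x : smooth U X -> U x -> D X (cst 0) x = 0.
Proof.
case: affD => _ _ addD _ sX Ux.
have := addD X (cst 0) (cst 0) sX (smooth_cst _) (smooth_cst _) x Ux.
rewrite (_ : (fun y => _) = cst 0); last by apply/funext => y; rewrite /cst addr0.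
by move/eqP; rewrite -subr_eq subrr eq_sym => /eqP.
Qed.

Lemma connection_components (u : 'rV[R]_(n + n)) (W : vfield R n) x :
  smooth U W -> U x ->
  D (cst u) W x = 'D_u W x + \sum_i W x 0 i *: D (cst u) (cst (delta_mx 0 i)) x.
Proof.
move=> sW Ux; case: (affD) => _ _ addD leibD.
have sWi i : smooth U (fun y => W y 0 i) by move=> k; exact: (Ck_mxE _ _ oU).1 (sW k) 0 i.
have sWd i : smooth U (fun y => W y 0 i *: (delta_mx 0 i : 'rV[R]_(n + n))).
  by move=> k; apply: CkZl => //; exact: sWi.
have dW : derivable W x u by have [dW _] := sW 1%N; apply/diff_derivable/dW.
have DWE (r : seq 'I_(n + n)) :
    D (cst u) (fun y => \sum_(i <- r) W y 0 i *: delta_mx 0 i) x =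
    \sum_(i <- r) ('D_u (fun y => W y 0 i) x *: delta_mx 0 i +
                   W x 0 i *: D (cst u) (cst (delta_mx 0 i)) x).
  elim: r => [|i r IH].
    rewrite big_nil (_ : (fun y => _) = cst 0); last by apply/funext => y; rewrite big_nil.
    by apply: connection0r => //; exact: smooth_cst.
  rewrite big_cons -IH.
  rewrite (_ : (fun y => _) = (fun y => W y 0 i *: (delta_mx 0 i : 'rV[R]_(n + n)) +
     \sum_(i <- r) W y 0 i *: delta_mx 0 i)); last by apply/funext => y; rewrite big_cons.
  rewrite addD //; [|exact: smooth_cst|by move=> k; apply: Ck_sum => // j; exact: sWd].
  congr (_ + _).
  exact: (leibD (fun y => W y 0 i) (cst u) (cst (delta_mx 0 i)) (sWi i) (smooth_cst _)
    (smooth_cst _) x Ux).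
rewrite {1}(_ : W = (fun y => \sum_i W y 0 i *: delta_mx 0 i)); last first.
  by apply/funext => y; rewrite -row_sum_delta.
rewrite DWE big_split /=; congr (_ + _).
rewrite derive_mx // [RHS]row_sum_delta; apply: eq_bigr => i _.
by rewrite mxE.
Qed.

End connection.

Context (G : 'rV[R]_(n + n) -> 'M[R]_(n + n)) (th : 'rV[R]_(n + n) -> 'rV[R]_(n + n)).
Context (D : vfield R n -> vfield R n -> vfield R n) (t : R).
Context (smoothG : smooth U G) (smooth_th : smooth U th).
Context (symG : forall x u v, U x -> bilin (G x) u v = bilin (G x) v u).
Context (posG : forall x u, U x -> u != 0 -> 0 < bilin (G x) u u).
Context (hermG : forall x u v, U x ->
  bilin (G x) (stdJ u) (stdJ v) = bilin (G x) u v).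
Context (lcKG : forall x u v z, U x ->
  ext_d2 (fun y => fundamental (G y)) x u v z =
  wedge12 (pairing (th x)) (fundamental (G x)) u v z).
Context (affD : affine_connection U D).
Context (torsionD : forall X Y : vfield R n, smooth U X -> smooth U Y ->
  forall x, U x -> D X Y x - D Y X x = bracket X Y x).
Context (metricD : forall X Y Z : vfield R n,
  smooth U X -> smooth U Y -> smooth U Z -> forall x, U x ->
  'D_(X x) (fun y => bilin (G y) (Y y) (Z y)) x =
  bilin (G x) (D X Y x) (Z x) + bilin (G x) (Y x) (D X Z x)).

Lemma bracket_cst (u v : 'rV[R]_(n + n)) : bracket (cst u) (cst v) = cst 0.
Proof. by apply/funext => x; rewrite /bracket !derive_cst subrr. Qed.

Let dG x u v w := 'D_u (fun y => bilin (G y) v w) x.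

Lemma koszul x u v w : U x ->
  2 * bilin (G x) (D (cst u) (cst v) x) w = dG x u v w + dG x v u w - dG x w u v.
Proof.
move=> Ux.
have dGE a b c : dG x a b c =
    bilin (G x) (D (cst a) (cst b) x) c + bilin (G x) b (D (cst a) (cst c) x).
  exact: (metricD (smooth_cst a) (smooth_cst b) (smooth_cst c) Ux).
have tor a b : D (cst a) (cst b) x = D (cst b) (cst a) x.
  apply/eqP; rewrite -subr_eq0 (torsionD (smooth_cst a) (smooth_cst b) Ux).
  by rewrite bracket_cst.
rewrite !dGE (tor v u) (tor w u) (tor w v).
rewrite !(symG u _ Ux) !(symG v _ Ux); ring.
Qed.

Lemma connection_J x u v w : U x ->
  2 * (bilin (G x) (D (cst u) (cst (stdJ v)) x) w +
       bilin (G x) (D (cst u) (cst v) x) (stdJ w)) =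
  wedge12 (pairing (th x)) (fundamental (G x)) u v w -
  wedge12 (pairing (th x)) (fundamental (G x)) u (stdJ v) (stdJ w).
Proof.
move=> Ux; rewrite -!lcKG// mulrDr !koszul// /ext_d2.
have dJJ a b c : dG x a (stdJ b) (stdJ c) = dG x a b c.
  by apply: (eq_derive_open _ oU Ux) => y Uy; exact: hermG.
have dJ a b c : dG x a (stdJ b) c = - dG x a b (stdJ c).
  rewrite -[RHS]opprK; apply: esym; rewrite opprK.
  have dd : derivable (fun y => bilin (G y) b (stdJ c)) x a.
    have [dd _] := Ck_bilin (smoothG 1%N) (Ck_cst U 1 b) (Ck_cst U 1 (stdJ c)).
    exact/diff_derivable/dd.
  rewrite /dG -deriveN//; apply: (eq_derive_open _ oU Ux) => y Uy.
  by rewrite (bilin_Jskew _ _ (fun u v => hermG u v Uy)).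
have E a b c : 'D_a (fun y => fundamental (G y) b c) x = dG x a (stdJ b) c by [].
rewrite !E !dJJ (dJ v u w) (dJ w u v) (dJ u v w); ring.
Qed.

Let unitG x : U x -> G x \in unitmx.
Proof.
move=> Ux; have sGx := bilin_trmx (fun u v => symG u v Ux).
by have [E /orthonormal_unitmx] := orthonormal_matrix sGx (fun u => posG Ux).
Qed.

Let gamma := gauduchon t G th D.

Lemma gauduchon_J x u v : U x ->
  gamma (cst u) (cst (stdJ v)) x = stdJ (gamma (cst u) (cst v) x).
Proof.
move=> Ux; apply: (bilin_inj (fun u => posG (u := u) Ux)) => w.
have skew a b := bilin_Jskew a b (fun u v => hermG u v Ux).
rewrite [RHS]skew; have := connection_J u v w Ux.
rewrite /wedge12 /gamma /gauduchon /fundamental /cst !stdJK.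
rewrite !(bilinDl, bilinNl, bilinZl) !(hermG _ _ Ux) !(skew, stdJK, bilinNr, pairingN).
rewrite !bilin_sharp ?unitG//.
set P := bilin _ (D _ _ _) w; set Q := bilin _ (D _ _ _) (stdJ w) => PQ.
have -> : P = 2^-1 * (2 * (P + Q)) - Q by field.
by rewrite PQ; field.
Qed.

Lemma gauduchonE (X Y : vfield R n) x :
  gamma X Y x = D X Y x + gauduchon t G th (fun _ _ => cst 0) X Y x.
Proof. by rewrite /gamma /gauduchon add0r !addrA. Qed.

Lemma gauduchon_tensor (X Y : vfield R n) x :
  gauduchon t G th (fun _ _ => cst 0) X Y x =
  gauduchon t G th (fun _ _ => cst 0) (cst (X x)) (cst (Y x)) x.
Proof. by []. Qed.

Lemma gauduchon_tensor_sum (u w : 'rV[R]_(n + n)) x :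
  gauduchon t G th (fun _ _ => cst 0) (cst u) (cst w) x =
  \sum_i w 0 i *: gauduchon t G th (fun _ _ => cst 0) (cst u) (cst (delta_mx 0 i)) x.
Proof.
pose L v := gauduchon t G th (fun _ _ => cst 0) (cst u) (cst v) x.
have linL a v v' : L (a *: v + v') = a *: L v + L v'.
  rewrite /L /gauduchon /fundamental /cst /=.
  have -> : pairing (th x) (stdJ (a *: v + v')) =
      a * pairing (th x) (stdJ v) + pairing (th x) (stdJ v').
    by rewrite stdJD stdJZ /pairing linearP mulmxDr -scalemxAr !mxE.
  have -> : pairing (th x) (a *: v + v') = a * pairing (th x) v + pairing (th x) v'.
    by rewrite /pairing linearP mulmxDr -scalemxAr !mxE.
  rewrite stdJD stdJZ !bilinDr !bilinZr.
  move: (pairing _ _) (pairing _ _) (pairing _ _) (pairing _ _) (pairing _ _).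
  move: (bilin _ _ _) (bilin _ _ _) (bilin _ _ _) (bilin _ _ _) => *.
  by apply/rowP => i; rewrite !mxE; ring.
rewrite -[LHS]/(L w) {1}(row_sum_delta w).
elim: (index_enum _) => [|i r IH]; last by rewrite !big_cons linL IH.
rewrite !big_nil; have := linL (-1) 0 0.
by rewrite !scaleN1r addr0 oppr0 addNr.
Qed.

Lemma Ck_gauduchon_tensor k (X Y : vfield R n) : Ck k U X -> Ck k U Y ->
  Ck k U (gauduchon t G th (fun _ _ => cst 0) X Y).
Proof.
move=> cX cY; have cth := smooth_th k; have cG := smoothG k.
have csharp : Ck k U (fun x => sharp (G x) (th x)).
  by apply: Ck_mulmx => //; exact: Ck_invmx.
have cs (a : R) f Z : Ck k U f -> Ck k U Z -> Ck k U (fun x => (a * f x) *: (Z x : 'rV[R]_(n + n))).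
  move=> cf cZ; apply: Ck_scale => //; apply: CkM => //; exact: Ck_cst.
have cpair := Ck_pairing; have cbil := Ck_bilin; have cJ := Ck_stdJ.
have cN Z : Ck k U Z -> Ck k U (fun x => - (Z x : 'rV[R]_(n + n))).
  move=> cZ; apply: eq_Ck (Ck_scale oU (Ck_cst U k (-1 : R)) cZ) => // x _.
  by rewrite /cst scaleN1r.
apply: CkD => //; last by apply: cs => //; exact: cbil.
apply: CkD => //; last by apply/cN/cs => //; exact: cpair.
apply: CkD => //; last by apply: cs; [apply: cbil => //; exact: cJ|exact: cJ].
apply: CkD => //; last by apply: cs; [apply: cpair => //; exact: cJ|exact: cJ].
apply: CkD => //; first exact: Ck_cst.
by apply/cN/cs; [apply: cpair => //; exact: cJ|exact: cJ].
Qed.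

Lemma smooth_gauduchon (X Y : vfield R n) :
  smooth U X -> smooth U Y -> smooth U (gamma X Y).
Proof.
move=> sX sY k; case: affD => sD _ _ _.
apply: eq_Ck (CkD oU (sD X Y sX sY k) (Ck_gauduchon_tensor (sX k) (sY k))) => // x _.
by rewrite gauduchonE.
Qed.

Definition gauduchon_mx (u x : 'rV[R]_(n + n)) : 'M[R]_(n + n) :=
  \matrix_i gamma (cst u) (cst (delta_mx 0 i)) x.

Lemma smooth_gauduchon_mx u : smooth U (gauduchon_mx u).
Proof.
move=> k; apply/(Ck_mxE _ _ oU) => i j.
have := smooth_gauduchon (smooth_cst u) (smooth_cst (delta_mx 0 i)) k.
by move/(Ck_mxE _ _ oU)/(_ 0 j); apply: eq_Ck => // x _; rewrite [RHS]mxE.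
Qed.

Lemma gauduchon_mxE u (W : vfield R n) x : smooth U W -> U x ->
  gamma (cst u) W x = 'D_u W x + W x *m gauduchon_mx u x.
Proof.
move=> sW Ux; rewrite gauduchonE (connection_components affD)// -addrA; congr (_ + _).
rewrite gauduchon_tensor gauduchon_tensor_sum -big_split mulmx_sum_row.
by apply: eq_bigr => i _; rewrite /= -scalerDr rowK gauduchonE.
Qed.

Lemma gauduchon_mxJ u x : U x ->
  gauduchon_mx u x *m Jmx n = Jmx n *m gauduchon_mx u x.
Proof.
move=> Ux; apply/row_matrixP => i; rewrite !row_mul rowK -stdJE -gauduchon_J//.
rewrite gauduchon_mxE//; last exact: smooth_cst.
by rewrite derive_cst add0r /cst stdJE -rowE.
Qed.

Lemma gauduchon_curvature u v w x : U x ->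
  curvature gamma (cst u) (cst v) (cst w) x =
  w *m ('D_u (gauduchon_mx v) x - 'D_v (gauduchon_mx u) x
        + (gauduchon_mx v x *m gauduchon_mx u x - gauduchon_mx u x *m gauduchon_mx v x)).
Proof.
move=> Ux; rewrite /curvature bracket_cst.
have gcst a b y : U y -> gamma (cst a) (cst b) y = b *m gauduchon_mx a y.
  by move=> Uy; rewrite gauduchon_mxE ?derive_cst ?add0r//; exact: smooth_cst.
have g2 a b : gamma (cst a) (gamma (cst b) (cst w)) x =
    w *m 'D_a (gauduchon_mx b) x + w *m (gauduchon_mx b x *m gauduchon_mx a x).
  rewrite gauduchon_mxE//; last by apply: smooth_gauduchon; exact: smooth_cst.
  rewrite gcst// mulmxA; congr (_ + _).
  rewrite (eq_derive_open a oU Ux (gcst b w)).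
  have [dg _] := smooth_gauduchon_mx b 1%N.
  exact: (derive_linear (mulmx w) a (dg x Ux)).
have g0 : gamma (cst 0) (cst w) x = 0.
  rewrite gauduchonE (connection0l affD (smooth_cst w) Ux) add0r /gauduchon /cst.
  have J0 : stdJ 0 = 0 :> 'rV[R]_(n + n) by rewrite stdJE mul0mx.
  rewrite /fundamental /bilin /pairing J0 trmx0 !mulmx0 !mul0mx !mxE !mulr0.
  by rewrite !scaler0 !scale0r !(subr0, addr0).
by rewrite !g2 g0 subr0 !mulmxDr !mulmxN opprD addrACA.
Qed.

Lemma ricci_trace (E : 'M[R]_(n + n)) u v x : U x -> E *m G x *m E^T = 1%:M ->
  - 2^-1 * \sum_i bilin (G x) (curvature gamma (cst u) (cst v) (cst (row i E)) x)
    (stdJ (row i E)) =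
  2^-1 * ('D_u (fun y => \tr (gauduchon_mx v y *m Jmx n)) x
          - 'D_v (fun y => \tr (gauduchon_mx u y *m Jmx n)) x).
Proof.
move=> Ux EG; under eq_bigr do rewrite gauduchon_curvature//.
rewrite (trace_orthonormal _ (fun u v => hermG u v Ux) EG) mulrNN; congr (_ * _).
have dtr a b : 'D_a (fun y => \tr (gauduchon_mx b y *m Jmx n)) x =
    \tr ('D_a (gauduchon_mx b) x *m Jmx n).
  have [dg _] := smooth_gauduchon_mx b 1%N.
  exact: (derive_linear ((@mxtrace R _ : _ -> R^o) \o mulmxr (Jmx n)) a (dg x Ux)).
rewrite !dtr mulmxDl mulmxBl !linearD linearN /= trace_commutator ?addr0//.
exact: gauduchon_mxJ.
Qed.

(* [fun v => tr (gauduchon_mx v J)] is a primitive of twice the Ricci form, which is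
   therefore closed: [d (F omega) = (dF + F theta) /\ omega] vanishes. *)
Lemma einstein_factor (F : 'rV[R]_(n + n) -> R) : (2 <= n)%N -> smooth U F ->
  (forall x e u v, U x -> orthonormal_basis (G x) e ->
     - 2^-1 * \sum_i bilin (G x) (curvature gamma (cst u) (cst v) (cst (e i)) x)
       (stdJ (e i)) = F x * fundamental (G x) u v) ->
  forall x v, U x -> 'D_v F x = - (F x * pairing (th x) v).
Proof.
move=> n2 sF ricF x w Ux.
pose a v y := \tr (gauduchon_mx v y *m Jmx n).
have sa v : smooth U (a v).
  move=> k; have := Ck_mulmx oU (smooth_gauduchon_mx v k) (Ck_cst U k (Jmx n)).
  by move=> /(Ck_mxE _ _ oU) c; apply: Ck_sum.
have Fom y u v : U y -> F y * fundamental (G y) u v = 2^-1 * ('D_u (a v) y - 'D_v (a u) y).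
  move=> Uy; have sGy := bilin_trmx (fun u v => symG u v Uy).
  have [E EG] := orthonormal_matrix sGy (fun u => posG (u := u) Uy).
  rewrite -(ricci_trace u v Uy EG) -(ricF _ (fun i => row i E))//.
  by move=> i j; rewrite bilin_row EG mxE.
have dF v : derivable F x v by have [dF _] := sF 1%N; exact/diff_derivable/dF.
have dom b c v : derivable (fun y => fundamental (G y) b c) x v.
  have [dd _] := Ck_bilin (smoothG 1%N) (Ck_cst U 1 (stdJ b)) (Ck_cst U 1 c).
  exact/diff_derivable/dd.
have dda b c v : derivable ('D_b (a c)) x v.
  by have [_ /(_ b)[dd _]] := sa c 2%N; exact/diff_derivable/dd.
have E z b c : 2^-1 * ('D_z ('D_b (a c)) x - 'D_z ('D_c (a b)) x) =
    F x * 'D_z (fun y => fundamental (G y) b c) x + 'D_z F x * fundamental (G x) b c.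
  have -> : F x * 'D_z (fun y => fundamental (G y) b c) x + 'D_z F x * fundamental (G x) b c =
     'D_z (fun y => F y * fundamental (G y) b c) x.
    by rewrite (@deriveM _ _ F (fun y => fundamental (G y) b c)) // addrC [RHS]addrC mulrC.
  rewrite (eq_derive_open z oU Ux (fun y Uy => Fom y b c Uy)).
  rewrite -deriveB// -[LHS]/(2^-1 *: 'D_z ('D_b (a c) - 'D_c (a b)) x) -deriveZ//.
  exact: derivableB.
apply/eqP; rewrite -addr_eq0; apply/eqP.
apply: (@wedge_fundamental_inj _ n (G x) (fun v => 'D_v F x + F x * pairing (th x) v)) w => //.
- by move=> u; exact: posG.
- by move=> u v; exact: symG.
- by move=> u v; exact: hermG.
move=> u v z.
have S b c d : 'D_b ('D_c (a d)) x = 'D_c ('D_b (a d)) x.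
  exact: derive_comm oU Ux (sa d 2%N).
exact: (@closed_multiple_wedge _ R (F x) (fun v => 'D_v F x) (pairing (th x))
  (fundamental (G x)) (fun z b c => 'D_z (fun y => fundamental (G y) b c) x)
  (fun b c d => 'D_b ('D_c (a d)) x) S E (fun u v z => lcKG u v z Ux)).
Qed.

End chart.

(** * Globalization *)

Lemma neg_ln_primitive (R : realType) (V : normedModType R) (U : set V)
    (F : V -> R) (a : V -> V -> R) : open U ->
  (forall x, U x -> 0 < F x) -> smooth U F -> (forall v, smooth U (a ^~ v)) ->
  (forall x v, U x -> 'D_v F x = - (F x * a x v)) ->
  smooth U (fun x => - ln (F x)) /\
  forall x v, U x -> 'D_v (fun x => - ln (F x)) x = a x v.
Proof.
move=> oU F0 sF sa dFE.
have dF x : U x -> differentiable F x by move=> Ux; have [dF _] := sF 1%N; exact: dF.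
have dln x : U x -> is_derive (F x) 1 (@ln R) (F x)^-1.
  by move=> Ux; apply: is_derive1_ln; exact: F0.
have dlF x : U x -> differentiable (@ln R \o F) x.
  move=> Ux; apply: differentiable_comp; first exact: dF.
  by apply/derivable1_diffP; have [] := dln x Ux.
have dlFE x v : U x -> 'D_v (fun x => - ln (F x)) x = a x v.
  move=> Ux; have dlnF : differentiable (@ln R) (F x).
    by apply/derivable1_diffP; have [] := dln x Ux.
  have dlFx := dlF x Ux; have dFx := dF x Ux.
  have -> : (fun x => - ln (F x)) = - (@ln R \o F) by [].
  rewrite deriveN; last exact: diff_derivable.
  have -> : 'D_v (@ln R \o F) x = (F x)^-1 * 'D_v F x.
    have [_ <-] := dln x Ux; rewrite !deriveE // diff_comp //=.
    move: ('d F x v) => c; rewrite -[in LHS](mulr1 c) -[c * 1]/(c *: 1) linearZ /=.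
    by rewrite -[LHS]/(c * _) mulrC.
  rewrite dFE // mulrN opprK mulrA mulVf ?mul1r//.
  by rewrite gt_eqF// F0.
split=> //; case=> [|k].
  by move=> x Ux; apply: differentiable_continuous; apply: differentiableN; exact: dlF.
split=> [x Ux|v]; first by apply: differentiableN; exact: dlF.
by apply: eq_Ck (sa v k) => // x Ux; rewrite dlFE.
Qed.

Section manifold.
Context {R : realType} {n : nat} (M : complexManifold R n).

Lemma chart_cvg (c : chart_index M) (p : M) : chart_dom M c p ->
  chart M c @ p --> chart M c p.
Proof.
have /= := @chart_continuous R n M c.
rewrite continuous_open_subspace; last exact: chart_dom_open.
by move=> cc cp; apply: cc; rewrite inE.
Qed.

Lemma nbhs_chart (c : chart_index M) (p : M) (P : set 'rV[R]_(n + n)) :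
  chart_dom M c p -> nbhs (chart M c p) P ->
  \forall q \near p, chart_dom M c q /\ P (chart M c q).
Proof.
move=> cp nP; apply: filterI; last exact: (chart_cvg cp nP).
by apply: open_nbhs_nbhs; split=> //; exact: chart_dom_open.
Qed.

Lemma smooth_fun_continuous (f : M -> R) : smooth_fun f -> continuous f.
Proof.
move=> sf p; have [c cp] := chart_dom_cover p.
have Up : chart_image c (chart M c p) by exists p.
have cF : {for chart M c p, continuous (f \o chart_inv M c)}.
  exact: (Ck_continuous (sf c 0%N) Up).
move=> A; rewrite -{1}(chartK cp) => nA.
have := nbhs_chart cp (cF A nA); apply: filterS => q [cq] /=.
by rewrite chartK.
Qed.

Lemma clopen_setT (A : set M) : connected [set: M] -> A !=set0 ->
  open A -> open (~` A) -> A = setT.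
Proof.
move=> cM A0 oA oCA; apply: cM => //; first by exists A; rewrite ?setTI.
by exists A; rewrite ?setTI// -openC.
Qed.

Lemma zero_set_open (f : M -> R) (theta : oneForm M) : smooth_fun f ->
  (forall c x v, chart_image c x ->
     'D_v (f \o chart_inv M c) x = - (f (chart_inv M c x) * pairing (theta c x) v)) ->
  open [set p | f p = 0].
Proof.
move=> sf dF; rewrite openE => p /= fp0; have [c cp] := chart_dom_cover p.
pose U := chart_image c; have oU : open U by exact: chart_image_open.
have Up : U (chart M c p) by exists p.
have /nbhs_ballP[e /= e0 eU] : nbhs (chart M c p) U by exact: open_nbhs_nbhs.
have F0 : forall y, ball (chart M c p) e y -> (f \o chart_inv M c) y = 0.
  apply: (@linear_pde_eq0 _ _ U _ (fun y v => - pairing (theta c y) v)) => //.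
  - move=> y v Uy; split; last by rewrite dF //= mulrN.
    by have [d _] := sf c 1%N; exact/diff_derivable/d.
  - move=> y v Uy; apply: continuousN.
    exact: (Ck_continuous (Ck_pairing oU (form_smooth theta c 0%N) (Ck_cst U 0 v)) Uy).
  - by rewrite /= chartK.
have := nbhs_chart cp (nbhsx_ballx (chart M c p) e e0).
by apply: filterS => q [cq /F0]; rewrite /= chartK.
Qed.

End manifold.

Theorem proposition2p1 (R : realType) (n : nat) (hn : (3 <= n)%N)
    (M : complexManifold R n)
    (hcompact : compact [set: M]) (hconnected : connected [set: M])
    (t : R) (g : hermitianMetric M) (theta : oneForm M) (hlcK : lcK g theta)
    (nabla : chart_index M -> vfield R n -> vfield R n -> vfield R n)
    (hnabla : levi_civita g nabla)
    (f : M -> R) (hf : smooth_fun f)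
    (hRic : forall (c : chart_index M) (x : 'rV[R]_(n + n))
        (e : 'I_(n + n) -> 'rV[R]_(n + n)) (u v : 'rV[R]_(n + n)),
      chart_image c x -> orthonormal_basis (g c x) e ->
      gauduchon_ricci1 t g theta nabla c x e u v =
      f (chart_inv M c x) * fundamental (g c x) u v) :
  (forall p : M, f p = 0) \/
  (globally_conformally_kaehler g theta /\
   ((forall p : M, 0 < f p) \/ (forall p : M, f p < 0))).
Proof.
have n2 : (2 <= n)%N by exact: ltnW.
have oU c : open (chart_image (M := M) c) by exact: chart_image_open.
have dF c x v : chart_image c x ->
    'D_v (f \o chart_inv M c) x = - (f (chart_inv M c x) * pairing (theta c x) v).
  have [affD torD metD] := hnabla c; have [_ lcKg] := hlcK.
  apply: (@einstein_factor _ _ _ (oU c) (g c) (theta c) (nabla c) t) => //.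
  - exact: metric_smooth.
  - exact: form_smooth.
  - exact: Defs.metric_sym.
  - exact: metric_pos.
  - exact: metric_hermitian.
  - exact: lcKg.
  - by move=> y e u w Uy eo; exact: (hRic c y e u w Uy eo).
have cf := smooth_fun_continuous hf.
have opos : open [set p | 0 < f p].
  by rewrite openE => p /= fp; exact: (cvgr_gt _ (cf p) _ fp).
have oneg : open [set p | f p < 0].
  by rewrite openE => p /= fp; exact: (cvgr_lt _ (cf p) _ fp).
have [[p0 fp0]|nf] := pselect (exists p, f p = 0).
  left; have : [set p | f p = 0] = [set: M].
    apply: clopen_setT => //; first by exists p0.
      exact: zero_set_open hf dF.
    rewrite (_ : ~` _ = [set p | 0 < f p] `|` [set p | f p < 0]); first exact: openU.
    apply/seteqP; split=> p /=; first by move/eqP; rewrite neq_lt => /orP[]; [right|left].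
    by case=> fp0' fp; rewrite fp ltxx in fp0'.
  by move=> E p; have : [set p | f p = 0] p by rewrite E.
right; have f0 p : f p != 0 by apply/eqP => fp0; apply: nf; exists p.
have sgnf : (forall p, 0 < f p) \/ (forall p, f p < 0).
  have [[p1 fp1]|nf1] := pselect (exists p, 0 < f p); last first.
    by right=> p; rewrite lt_neqAle f0 leNgt; apply/negP => fp; apply: nf1; exists p.
  left; have E : [set p | 0 < f p] = [set: M].
    apply: clopen_setT => //; first by exists p1.
    rewrite (_ : ~` _ = [set p | f p < 0]) //.
    apply/seteqP; split=> p /=; last by move=> fp; apply/negP; rewrite -leNgt ltW.
    by move/negP; rewrite -leNgt le_eqVlt (negPf (f0 p)).
  by move=> p; have : [set p | 0 < f p] p by rewrite E.
split=> //; split=> //.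
have spair c v : smooth (chart_image c) (fun x => pairing (theta c x) v).
  by move=> k; exact: (Ck_pairing (oU c) (form_smooth theta c k) (Ck_cst _ k v)).
case: sgnf => [fpos|fneg].
  exists (fun p => - ln (f p)); split=> c.
    exact: (neg_ln_primitive (oU c) (fun x _ => fpos _) (hf c) (spair c) (dF c)).1.
  exact: (neg_ln_primitive (oU c) (fun x _ => fpos _) (hf c) (spair c) (dF c)).2.
have fpos c x : chart_image c x -> 0 < - f (chart_inv M c x) by rewrite oppr_gt0.
have sN c : smooth (chart_image c) (fun x => - (f \o chart_inv M c) x).
  move=> k; have := CkM (oU c) (Ck_cst _ k (-1 : R)) (hf c k).
  by apply: eq_Ck (oU c) _ => x _; rewrite /cst mulN1r.
have dN c x v : chart_image c x -> 'D_v (fun x => - (f \o chart_inv M c) x) x =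
    - (- (f \o chart_inv M c) x * pairing (theta c x) v).
  move=> Ux; rewrite (@deriveN _ _ _ (f \o chart_inv M c)) ?dF ?mulNr//.
  by have [d _] := hf c 1%N; exact/diff_derivable/d.
exists (fun p => - ln (- f p)); split=> c.
  exact: (neg_ln_primitive (oU c) (fpos c) (sN c) (spair c) (dN c)).1.
exact: (neg_ln_primitive (oU c) (fpos c) (sN c) (spair c) (dN c)).2.
Qed.
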